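(* Let $(\mathfrak h,[\,,\,]_{\mathfrak h})$ be a (finite-dimensional real) Lie algebra, $r\in\wedge^2\mathfrak h$ and $\bar X_0\in\mathfrak h$ such that $$[r,r]_{\mathfrak h}-2\bar X_0\wedge r=0,\qquad[\bar X_0,r]_{\mathfrak h}=0.$$ Let $\mathfrak g=\mathfrak h\times\mathbb R$ with the Lie bracket $[(X,\lambda),(Y,\mu)]=([X,Y]_{\mathfrak h},0)$, and equip $\mathfrak g^*\cong\mathfrak h^*\times\mathbb R$ with the bracket $$[(\alpha,\lambda),(\beta,\mu)]_*=\big(\mathrm{coad}_{\#_r(\alpha)}\beta-\mathrm{coad}_{\#_r(\beta)}\alpha-i_{\bar X_0}(\alpha\wedge\beta)-\mu\,\mathrm{coad}_{\bar X_0}\alpha+\lambda\,\mathrm{coad}_{\bar X_0}\beta,\ -r(\alpha,\beta)\big).$$ Then the pair $((\mathfrak g,(0,1)),(\mathfrak g^*,(-\bar X_0,0)))$ is a generalized Lie bialgebra.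
   Context: Here $\mathrm{coad}:\mathfrak h\times\mathfrak h^*\to\mathfrak h^*$ is $(\mathrm{coad}_X\alpha)(Y)=-\alpha([X,Y]_{\mathfrak h})$; $\#_r:\mathfrak h^*\to\mathfrak h$ is defined by $\beta(\#_r(\alpha))=r(\alpha,\beta)$; $i_X(\alpha\wedge\beta)=\alpha(X)\beta-\beta(X)\alpha$; the pairing of $\mathfrak g^*=\mathfrak h^*\times\mathbb R$ with $\mathfrak g=\mathfrak h\times\mathbb R$ is $(\alpha,\lambda)(X,\mu)=\alpha(X)+\lambda\mu$. The bracket of a Lie algebra $\mathfrak g$ is extended to the Schouten bracket on $\wedge^*\mathfrak g$, the bilinear extension with $[X,c]=0$ for scalars $c$, $[P,P']=(-1)^{kk'}[P',P]$, $[P,P'\wedge P'']=[P,P']\wedge P''+(-1)^{k'(k+1)}P'\wedge[P,P'']$ for $P\in\wedge^k\mathfrak g$, $P'\in\wedge^{k'}\mathfrak g$. An element $\phi_0\in\mathfrak g^*$ is a 1-cocycle on $\mathfrak g$ if $\phi_0([X,Y])=0$ for all $X,Y$. For such $\phi_0$, $[P,P']_{\phi_0}=[P,P']+(-1)^{k+1}(k-1)P\wedge i_{\phi_0}P'-(k'-1)(i_{\phi_0}P)\wedge P'$, with contraction in the first slot. A generalized Lie bialgebra is a pair $((\mathfrak g,\phi_0),(\mathfrak g^*,X_0))$ where $(\mathfrak g,[\,,\,])$ is a finite-dimensional real Lie algebra, $\mathfrak g^*$ is also a Lie algebra with bracket $[\,,\,]_*$, $\phi_0\in\mathfrak g^*$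 and $X_0\in\mathfrak g$ are 1-cocycles on $\mathfrak g$ and $\mathfrak g^*$ respectively, and for all $X,Y\in\mathfrak g$ $$d_{*X_0}[X,Y]=[X,d_{*X_0}Y]_{\phi_0}-[Y,d_{*X_0}X]_{\phi_0},\qquad\phi_0(X_0)=0,\qquad i_{\phi_0}(d_*X)+[X_0,X]=0,$$ where $d_*$ is the Chevalley–Eilenberg differential (trivial coefficients) of $(\mathfrak g^*,[\,,\,]_* )$ acting on $\wedge^*\mathfrak g$, so $(d_*X)(\alpha,\beta)=-[\alpha,\beta]_*(X)$, and $d_{*X_0}Q=d_*Q+X_0\wedge Q$. *)

(* Defs.v *)
From HB Require Import structures.
From mathcomp Require Import all_boot all_order all_algebra.
From mathcomp Require Import boolp functions reals.

Set Implicit Arguments.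
Unset Strict Implicit.
Unset Printing Implicit Defensive.
Import GRing.Theory Num.Theory.
Local Open Scope ring_scope.

Notation "{ 'dual' V }" := 'Hom(V, GRing.regular _)
  (at level 0, format "{ 'dual'  V }").

Record is_lie_bracket (R : realType) (V : vectType R) (br : V -> V -> V)
    : Prop := IsLieBracket {
  lie_linearl : forall Y, linear (br^~ Y);
  lie_linearr : forall X, linear (br X);
  lie_alt : forall X, br X X = 0;
  lie_jacobi : forall X Y Z,
    br X (br Y Z) + br Y (br Z X) + br Z (br X Y) = 0 }.

(* The exterior algebra of V (finite-dimensional) is realized inside functions
   on finite lists of covectors: an element P of degree k sends a list of k
   covectors a_1, .., a_k to P(a_1, .., a_k) and every list of another length to
   0, and is multilinear and alternating on lists of length k. *)
Definition mvec (R : realType) (V : vectType R) : Type := seq {dual V} -> R.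

Section MvecModule.
Variables (R : realType) (V : vectType R).

HB.instance Definition _ := GRing.Zmodule.copy (mvec V) (seq {dual V} -> R).

Definition mvec_scale (c : R) (P : mvec V) : mvec V := fun s => c * P s.

Fact mvec_scaleA c d P : mvec_scale c (mvec_scale d P) = mvec_scale (c * d) P.
Proof. by apply/funext => s; apply: mulrA. Qed.

Fact mvec_scale1 : left_id 1 mvec_scale.
Proof. by move=> P; apply/funext => s; apply: mul1r. Qed.

Fact mvec_scaleDr : right_distributive mvec_scale +%R.
Proof. by move=> c P Q; apply/funext => s; apply: mulrDr. Qed.

Fact mvec_scaleDl P : {morph mvec_scale^~ P : c d / c + d}.
Proof. by move=> c d; apply/funext => s; apply: mulrDl. Qed.

HB.instance Definition _ := GRing.Zmodule_isLmodule.Build R (mvec V)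
  mvec_scaleA mvec_scale1 mvec_scaleDr mvec_scaleDl.

End MvecModule.

Section Multivectors.
Variables (R : realType) (V : vectType R).
Implicit Types (P Q T : mvec V) (a b : {dual V}) (s : seq {dual V}).

Record is_kvector (k : nat) P : Prop := IsKvector {
  kvector_size : forall s, size s <> k -> P s = 0;
  kvector_linear : forall s1 s2,
    linear ((fun a => P (s1 ++ a :: s2)) : {dual V} -> R^o);
  kvector_alt : forall s, ~~ uniq s -> P s = 0 }.

Definition mv0 (c : R) : mvec V := fun s => if s is [::] then c else 0.

Definition mv1 (X : V) : mvec V := fun s => if s is [:: a] then a X else 0.

Definition contr a P : mvec V := fun s => P (a :: s).

Definition gsign P : mvec V := fun s => (-1) ^+ size s * P s.

(* Recursion on the arguments:
   i_a (P /\ Q) = (i_a P) /\ Q + (-1)^k P /\ (i_a Q) for P of degree k. It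
   unfolds to the signed sum over shuffles, without normalizing factor, so that
   (X /\ Y)(a, b) = a(X) b(Y) - a(Y) b(X); see wedge11 below. *)
Fixpoint wedge_rec P Q s {struct s} : R :=
  if s is a :: s' then
    wedge_rec (contr a P) Q s' + wedge_rec (gsign P) (contr a Q) s'
  else P [::] * Q [::].

Definition wedge P Q : mvec V := wedge_rec P Q.

Definition basis_vec (i : 'I_(\dim {:V})) : V := (vbasis {:V})`_i.

Definition basis_covec (i : 'I_(\dim {:V})) : {dual V} :=
  linfun (coord (vbasis {:V}) i : V -> R^o).

(* On decomposable elements,
     [X_1 /\ .. /\ X_k, Y_1 /\ .. /\ Y_l] = (-1)^(k+1) \sum_(i, j) (-1)^(i+j)
       [X_i, Y_j] /\ (X_1 /\ .. X_i omitted .. /\ X_k)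
                  /\ (Y_1 /\ .. Y_j omitted .. /\ Y_l),
   extended bilinearly; the contractions against a dual basis perform the
   omissions, and contr a \o gsign carries the sign (-1)^k. That this is the
   unique bilinear extension of br obeying the rules of the Schouten bracket
   (in the sign convention [P, Q] = (-1)^(kl) [Q, P]) is schouten_rulesP and
   schouten_unique below. *)
Definition schouten (br : V -> V -> V) P Q : mvec V :=
  \sum_i \sum_j
    - wedge (mv1 (br (basis_vec i) (basis_vec j)))
        (wedge (contr (basis_covec i) (gsign P)) (contr (basis_covec j) Q)).

Record schouten_rules (br : V -> V -> V) (S : mvec V -> mvec V -> mvec V)
    : Prop := SchoutenRules {
  schouten_linearl : forall Q, linear (S^~ Q);
  schouten_linearr : forall P, linear (S P);
  schouten_br : forall X Y, S (mv1 X) (mv1 Y) = mv1 (br X Y);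
  schouten_scal : forall X c, S (mv1 X) (mv0 c) = 0;
  schouten_sym : forall k l P Q, is_kvector k P -> is_kvector l Q ->
    S P Q = (-1) ^+ (k * l) *: S Q P;
  schouten_leibniz : forall k l m P Q T,
    is_kvector k P -> is_kvector l Q -> is_kvector m T ->
    S P (wedge Q T) =
      wedge (S P Q) T + (-1) ^+ (l * k.+1) *: wedge Q (S P T) }.

(* [P, Q]_phi for P of degree k and Q of degree l. *)
Definition schouten_phi (br : V -> V -> V) (phi : {dual V}) (k l : nat) P Q
    : mvec V :=
  schouten br P Q
  + ((-1) ^+ k.+1 * (k%:R - 1)) *: wedge P (contr phi Q)
  - (l%:R - 1) *: wedge (contr phi P) Q.

Definition delete (i : nat) s := take i s ++ drop i.+1 s.

(* Chevalley-Eilenberg differential of a Lie algebra structure brs on the dual: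
   (d P)(a_0, .., a_k) = \sum_(i < j) (-1)^(i + j)
      P([a_i, a_j], a_0, .., a_i omitted, .., a_j omitted, .., a_k). *)
Definition ce_diff (brs : {dual V} -> {dual V} -> {dual V}) P : mvec V :=
  fun s => \sum_(j < size s) \sum_(i < j)
    (-1) ^+ (i + j) * P (brs s`_i s`_j :: delete i (delete j s)).

Definition ce_diff_tw (brs : {dual V} -> {dual V} -> {dual V}) (X0 : V) P
    : mvec V :=
  ce_diff brs P + wedge (mv1 X0) P.

Record gen_lie_bialgebra (br : V -> V -> V) (phi0 : {dual V})
    (brs : {dual V} -> {dual V} -> {dual V}) (X0 : V) : Prop :=
  GenLieBialgebra {
  glb_lie : is_lie_bracket br;
  glb_lie_dual : is_lie_bracket brs;
  glb_cocycle : forall X Y, phi0 (br X Y) = 0;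
  glb_cocycle_dual : forall a b, brs a b X0 = 0;
  glb_compat : forall X Y,
    ce_diff_tw brs X0 (mv1 (br X Y)) =
      schouten_phi br phi0 1 2 (mv1 X) (ce_diff_tw brs X0 (mv1 Y))
      - schouten_phi br phi0 1 2 (mv1 Y) (ce_diff_tw brs X0 (mv1 X));
  glb_phi0X0 : phi0 X0 = 0;
  glb_contr : forall X,
    contr phi0 (ce_diff brs (mv1 X)) + schouten br (mv1 X0) (mv1 X) = 0 }.

Definition coad (br : V -> V -> V) (X : V) (a : {dual V}) : {dual V} :=
  linfun (fun Y => - a (br X Y) : R^o).

(* The vector #_r(a) with b(#_r(a)) = r(a, b), cf. sharpE. *)
Definition sharp (r : mvec V) (a : {dual V}) : V :=
  \sum_i r [:: a; basis_covec i] *: basis_vec i.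

End Multivectors.

Arguments wedge : simpl never.

Section Extension.
Variables (R : realType) (h : vectType R).

Definition ext_bracket (br : h -> h -> h) (A B : h * R^o) : h * R^o :=
  (br A.1 B.1, 0).

(* The identification of h^* x R with the dual of h x R and its inverse. *)
Definition ext_covec (a : {dual h}) (l : R) : {dual (h * R^o)%type} :=
  linfun (fun A : h * R^o => a A.1 + l * A.2 : R^o).

Definition covec_fst (u : {dual (h * R^o)%type}) : {dual h} :=
  linfun (fun X => u (X, 0) : R^o).

Definition covec_snd (u : {dual (h * R^o)%type}) : R := u (0, 1).

Definition star_bracket (br : h -> h -> h) (r : mvec h) (X0 : h)
    (u v : {dual (h * R^o)%type}) : {dual (h * R^o)%type} :=
  let a := covec_fst u in let l := covec_snd u in
  let b := covec_fst v in let m := covec_snd v in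
  ext_covec
    (coad br (sharp r a) b - coad br (sharp r b) a
     - (a X0 *: b - b X0 *: a)
     - m *: coad br X0 a + l *: coad br X0 b)
    (- r [:: a; b]).

End Extension.

Section MultivectorTheory.
Variables (R : realType) (V : vectType R).
Implicit Types (P Q T : mvec V) (X Y : V) (a b : {dual V}) (s : seq {dual V}).

Lemma mvDE P Q s : (P + Q) s = P s + Q s. Proof. by []. Qed.
Lemma mvNE P s : (- P) s = - P s. Proof. by []. Qed.
Lemma mvZE (c : R) P s : (c *: P) s = c * P s. Proof. by []. Qed.
Lemma mvzE s : (0 : mvec V) s = 0. Proof. by []. Qed.
Lemma mv_sumE I (r : seq I) (p : pred I) (F : I -> mvec V) s :
  (\sum_(i <- r | p i) F i) s = \sum_(i <- r | p i) F i s.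
Proof. by elim/big_rec2: _ => // i y x _ <-. Qed.

Definition mvE := (mvDE, mvNE, mvZE, mvzE, mv_sumE).

Lemma gsignE P s : gsign P s = (-1) ^+ size s * P s. Proof. by []. Qed.

Lemma contr_is_linear a : linear (@contr R V a).
Proof. by []. Qed.
HB.instance Definition _ a :=
  GRing.isLinear.Build R (mvec V) (mvec V) _ (@contr R V a)
    (contr_is_linear a).

Lemma gsign_is_linear : linear (@gsign R V).
Proof. by move=> c P Q; apply/funext => s; rewrite /gsign !mvE mulrDr mulrCA. Qed.
HB.instance Definition _ :=
  GRing.isLinear.Build R (mvec V) (mvec V) _ (@gsign R V) gsign_is_linear.

Lemma gsignK : involutive (@gsign R V).
Proof. by move=> P; apply/funext => s; rewrite /gsign mulrA -expr2 sqrr_sign mul1r. Qed.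

Lemma contr_gsign a P : contr a (gsign P) = - gsign (contr a P).
Proof. by apply/funext => s; rewrite mvE /contr /gsign /= exprS !mulN1r mulNr. Qed.

Lemma contr_wedge a P Q :
  contr a (wedge P Q) = wedge (contr a P) Q + wedge (gsign P) (contr a Q).
Proof. by []. Qed.


Lemma wedge_nil P Q : wedge P Q [::] = P [::] * Q [::]. Proof. by []. Qed.
Lemma wedge_cons P Q a s :
  wedge P Q (a :: s) = wedge (contr a P) Q s + wedge (gsign P) (contr a Q) s.
Proof. by []. Qed.

Lemma wedge_linearr P : linear (wedge P).
Proof.
move=> c Q T; apply/funext => s; elim: s P Q T => [|a s IH] P Q T.
  by rewrite !mvE !wedge_nil !mvE mulrDr mulrCA.
by rewrite !mvE !wedge_cons linearP !IH !mvE mulrDr addrACA.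
Qed.

Lemma wedge_linearl Q : linear ((fun P => wedge P Q) : mvec V -> mvec V).
Proof.
move=> c P T; apply/funext => s; elim: s P Q T => [|a s IH] P Q T.
  by rewrite !mvE !wedge_nil !mvE mulrDl mulrA.
by rewrite !mvE !wedge_cons !linearP !IH !mvE mulrDr addrACA.
Qed.

HB.instance Definition _ P :=
  GRing.isLinear.Build R (mvec V) (mvec V) _ (wedge P) (wedge_linearr P).

(* Bundled form of wedge^~ Q, to use the linear_* lemmas on the left. *)
Definition wedger Q P : mvec V := wedge P Q.
HB.instance Definition _ Q :=
  GRing.isLinear.Build R (mvec V) (mvec V) _ (wedger Q) (wedge_linearl Q).

Lemma wedge0l Q : wedge 0 Q = 0. Proof. exact: (linear0 (wedger Q)). Qed.
Lemma wedgeNl P Q : wedge (- P) Q = - wedge P Q.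
Proof. exact: (linearN (wedger Q)). Qed.
Lemma wedgeDl P T Q : wedge (P + T) Q = wedge P Q + wedge T Q.
Proof. exact: (linearD (wedger Q)). Qed.
Lemma wedgeZl c P Q : wedge (c *: P) Q = c *: wedge P Q.
Proof. exact: (linearZ_LR (wedger Q)). Qed.
Lemma wedge_suml I (r : seq I) (p : pred I) (F : I -> mvec V) Q :
  wedge (\sum_(i <- r | p i) F i) Q = \sum_(i <- r | p i) wedge (F i) Q.
Proof. exact: (linear_sum (wedger Q)). Qed.

Lemma wedge0r P : wedge P 0 = 0. Proof. exact: linear0. Qed.
Lemma wedgeNr P Q : wedge P (- Q) = - wedge P Q. Proof. exact: linearN. Qed.
Lemma wedgeDr P Q T : wedge P (Q + T) = wedge P Q + wedge P T.
Proof. exact: linearD. Qed.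
Lemma wedgeZr c P Q : wedge P (c *: Q) = c *: wedge P Q.
Proof. exact: linearZ_LR. Qed.
Lemma wedge_sumr I (r : seq I) (p : pred I) (F : I -> mvec V) P :
  wedge P (\sum_(i <- r | p i) F i) = \sum_(i <- r | p i) wedge P (F i).
Proof. exact: linear_sum. Qed.

Lemma gsign_wedge P Q : gsign (wedge P Q) = wedge (gsign P) (gsign Q).
Proof.
apply/funext => s; elim: s P Q => [|a s IH] P Q.
  by rewrite /gsign !wedge_nil /= !mul1r.
rewrite wedge_cons !contr_gsign wedgeNl wedgeNr !mvE -!IH !gsignE wedge_cons.
by rewrite exprS mulN1r mulrDr !mulNr.
Qed.

Lemma wedgeA P Q T : wedge P (wedge Q T) = wedge (wedge P Q) T.
Proof.
apply/funext => s; elim: s P Q T => [|a s IH] P Q T.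
  by rewrite !wedge_nil mulrA.
rewrite !wedge_cons !contr_wedge wedgeDr wedgeDl !mvE !IH gsign_wedge.
by rewrite addrA.
Qed.

(* Homogeneity up to parity, which is all the signs depend on. *)
Definition parity (k : nat) P := gsign P = (-1) ^+ k *: P.

Lemma contrZ c a P : contr a (c *: P) = c *: contr a P. Proof. by []. Qed.

Lemma gsignZ c P : gsign (c *: P) = c *: gsign P.
Proof. by apply/funext => s; rewrite !mvE !gsignE !mvE mulrCA. Qed.

Lemma parityZ k c P : parity k P -> parity k (c *: P).
Proof. by move=> hP; rewrite /parity gsignZ hP !scalerA mulrC. Qed.

Lemma parity_contr k P a : parity k P -> parity k.+1 (contr a P).
Proof.
move=> hP; rewrite /parity -[gsign _]opprK -contr_gsign hP.
by rewrite exprS mulN1r scaleNr.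
Qed.

Lemma sign_odd m n : odd m = odd n -> (-1) ^+ m = (-1) ^+ n :> R.
Proof. by move=> e; rewrite -signr_odd e signr_odd. Qed.

Lemma parity_nil k P : parity k P -> odd k -> P [::] = 0.
Proof.
move=> /(congr1 (fun T => T [::])); rewrite mvE /gsign /= mul1r -signr_odd.
move=> + kodd; rewrite kodd mulN1r => /eqP.
by rewrite -addr_eq0 -mulr2n mulrn_eq0 => /eqP.
Qed.

Lemma wedgeC k l P Q : parity k P -> parity l Q ->
  wedge P Q = (-1) ^+ (k * l) *: wedge Q P.
Proof.
move=> hP hQ; apply/funext => s; elim: s k l P Q hP hQ => [|a s IH] k l P Q hP hQ.
  rewrite mvE !wedge_nil mulrC; case/boolP: (odd (k * l)).
    by rewrite oddM => /andP[/(parity_nil hP)-> _]; rewrite !mulr0.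
  by rewrite -signr_odd => /negPf->; rewrite expr0 [RHS]mul1r.
rewrite mvE !wedge_cons (IH _ _ _ _ (parity_contr a hP) hQ).
rewrite hP hQ !wedgeZl !mvE (IH _ _ _ _ hP (parity_contr a hQ)) mvE.
rewrite mulrDr addrC !mulrA -!exprD; congr (_ * _ + _ * _).
  by apply: sign_odd; rewrite mulnS !oddD addKb.
by apply: sign_odd; rewrite mulSn addnC.
Qed.

Lemma linear_sumE (U W : lmodType R) (f : U -> W) I (r : seq I) (c : I -> R)
  (v : I -> U) : linear f ->
  f (\sum_(i <- r) c i *: v i) = \sum_(i <- r) c i *: f (v i).
Proof.
move=> lf; elim: r => [|i r IH]; last by rewrite !big_cons lf IH.
by rewrite !big_nil; have := lf (-1) 0 0; rewrite scaler0 add0r scaleN1r addNr.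
Qed.

Lemma vec_expand (X : V) : X = \sum_i basis_covec i X *: basis_vec i.
Proof.
rewrite {1}(coord_vbasis (memvf X)); apply: eq_bigr => i _.
by rewrite /basis_covec lfunE.
Qed.

Lemma covec_expand a : a = \sum_i a (basis_vec i) *: basis_covec i.
Proof.
apply/lfunP => X; rewrite {1}(vec_expand X) linear_sum sum_lfunE.
by apply: eq_bigr => i _; rewrite linearZ /= scale_lfunE [LHS]mulrC.
Qed.

Lemma contr_mv0 a c : contr a (mv0 c) = 0 :> mvec V. Proof. by []. Qed.

Lemma contr_mv1 a X : contr a (mv1 X) = mv0 (a X : R). Proof. by []. Qed.

Lemma gsign_mv0 c : gsign (mv0 c) = mv0 c :> mvec V.
Proof. by apply/funext => -[|b s]; rewrite /gsign /= ?mul1r ?mulr0. Qed.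

Lemma gsign_mv1 X : gsign (mv1 X) = - mv1 X.
Proof.
apply/funext => -[|b [|? s]]; rewrite mvE /gsign /= ?mulr0 ?oppr0 //.
by rewrite expr1 mulN1r.
Qed.

Lemma mv1_linear : linear (@mv1 R V : V -> mvec V).
Proof.
by move=> c X Y; apply/funext => -[|b [|? s]]; rewrite !mvE /= ?mulr0 ?addr0 // linearP.
Qed.

Lemma mv1N X : mv1 (- X) = - mv1 X.
Proof.
by apply/funext => -[|b [|? s]]; rewrite !mvE /= ?oppr0 // linearN.
Qed.

Lemma mv0Z c : mv0 c = c *: mv0 1 :> mvec V.
Proof. by apply/funext => -[|? ?]; rewrite mvE /= ?mulr1 ?mulr0. Qed.

Lemma wedge_mv0l c Q : wedge (mv0 c) Q = c *: Q.
Proof.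
apply/funext => s; elim: s Q => [|a s IH] Q; first by [].
by rewrite wedge_cons contr_mv0 wedge0l gsign_mv0 IH mvE add0r.
Qed.

Lemma wedge_mv0r c P : wedge P (mv0 c) = c *: P.
Proof.
apply/funext => s; elim: s P => [|a s IH] P; first by rewrite wedge_nil mulrC.
by rewrite wedge_cons contr_mv0 wedge0r IH mvE addr0.
Qed.

Lemma wedge11 X Y a b :
  wedge (mv1 X) (mv1 Y) [:: a; b] = (a X : R) * b Y - (a Y : R) * b X.
Proof.
rewrite wedge_cons !contr_mv1 gsign_mv1 wedgeNl wedge_mv0l wedge_mv0r !mvE /=.
by rewrite -mulNr.
Qed.

Section Kvectors.
Implicit Types (k l : nat).

Lemma kv_parity k P : is_kvector k P -> parity k P.
Proof.
move=> [Ps _ _]; apply/funext => s; rewrite gsignE mvE.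
by have [->//|/eqP sk] := eqVneq (size s) k; rewrite Ps // !mulr0.
Qed.

Lemma kv_contr k P a : is_kvector k.+1 P -> is_kvector k (contr a P).
Proof.
move=> [Ps Pl Pa]; split => [s sk|s1 s2|s su].
- by apply: Ps => /= -[].
- exact: (Pl (a :: s1) s2).
- by apply: Pa; rewrite /= negb_and su orbT.
Qed.

Lemma kv0_contr P a : is_kvector 0 P -> contr a P = 0.
Proof. by move=> [Ps _ _]; apply/funext => s; apply: Ps. Qed.

Lemma kv0E P : is_kvector 0 P -> P = mv0 (P [::]).
Proof. by move=> [Ps _ _]; apply/funext => -[|a s] //; apply: Ps. Qed.

Lemma kv_mv0 c : is_kvector 0 (mv0 c : mvec V).
Proof.
split => [[]//|s1 s2 d a b|[]//].
by case: s1 => [|x s1] /=; rewrite scaler0 addr0.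
Qed.

Lemma kv_mv1 X : is_kvector 1 (mv1 X).
Proof.
split => [[|a []]//|s1 s2 c a b|[|a []]//].
case: s1 s2 => [|x [|y s1]] [|z s2] /=; rewrite ?scaler0 ?addr0 //.
by rewrite add_lfunE scale_lfunE.
Qed.

Definition mlin P := forall s1 s2 (c : R) a b,
  P (s1 ++ (c *: a + b) :: s2) = c * P (s1 ++ a :: s2) + P (s1 ++ b :: s2).

Lemma kv_mlin k P : is_kvector k P -> mlin P.
Proof. by move=> [_ Pl _]; apply: Pl. Qed.

Lemma kv_intro k P : (forall s, size s <> k -> P s = 0) -> mlin P ->
  (forall s, ~~ uniq s -> P s = 0) -> is_kvector k P.
Proof. by move=> Ps Pl Pa; split. Qed.

Lemma kv_lin k c P Q :
  is_kvector k P -> is_kvector k Q -> is_kvector k (c *: P + Q).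
Proof.
move=> hP hQ; have Pl := kv_mlin hP; have Ql := kv_mlin hQ.
case: hP hQ => [Ps _ Pa] [Qs _ Qa]; apply: kv_intro => [s sk|s1 s2 d a b|s su].
- by rewrite !mvE Ps // Qs // mulr0 addr0.
- by rewrite !mvE Pl Ql !mulrDr mulrCA addrACA.
- by rewrite !mvE Pa // Qa // mulr0 addr0.
Qed.

Lemma kv_0 k : is_kvector k (0 : mvec V).
Proof. by split => // s1 s2 d a b; rewrite scaler0 addr0. Qed.

Lemma kv_scale k c P : is_kvector k P -> is_kvector k (c *: P).
Proof. by move=> hP; rewrite -[_ *: _]addr0; apply: kv_lin => //; apply: kv_0. Qed.

Lemma kv_sum k I (r : seq I) (p : pred I) (F : I -> mvec V) :
  (forall i, is_kvector k (F i)) -> is_kvector k (\sum_(i <- r | p i) F i).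
Proof.
move=> hF; elim/big_ind: _ => [|P Q hP hQ|//]; first exact: kv_0.
by rewrite -[P]scale1r; apply: kv_lin.
Qed.

Let adj P := forall s1 s2 a, P (s1 ++ a :: a :: s2) = 0.

Let mlin_contr P a : mlin P -> mlin (contr a P).
Proof. by move=> hP s1 s2; apply: (hP (a :: s1)). Qed.

Let mlin_gsign P : mlin P -> mlin (gsign P).
Proof.
by move=> hP s1 s2 c a b; rewrite !gsignE hP !size_cat /= mulrDr mulrCA.
Qed.

Let mlin_wedge P Q : mlin P -> mlin Q -> mlin (wedge P Q).
Proof.
move=> hP hQ s1; elim: s1 P Q hP hQ => [|x s1 IH] P Q hP hQ s2 c a b.
  rewrite /= !wedge_cons.
  have -> : contr (c *: a + b) P = c *: contr a P + contr b P.
    by apply/funext => s; apply: (hP [::] s).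
  have -> : contr (c *: a + b) Q = c *: contr a Q + contr b Q.
    by apply/funext => s; apply: (hQ [::] s).
  by rewrite wedgeDl wedgeDr wedgeZl wedgeZr !mvE mulrDr addrACA.
rewrite !cat_cons !wedge_cons IH ?[wedge (gsign P) _ _]IH;
  [|exact: mlin_gsign|exact: mlin_contr|exact: mlin_contr|exact: hQ].
by rewrite mulrDr addrACA.
Qed.

Let adj_contr P a : adj P -> adj (contr a P).
Proof. by move=> hP s1 s2 b; apply: (hP (a :: s1)). Qed.

Let adj_gsign P : adj P -> adj (gsign P).
Proof. by move=> hP s1 s2 b; rewrite gsignE hP mulr0. Qed.

Let adj_wedge P Q : adj P -> adj Q -> adj (wedge P Q).
Proof.
move=> hP hQ s1; elim: s1 P Q hP hQ => [|x s1 IH] P Q hP hQ s2 a.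
  have h T : adj T -> contr a (contr a T) = 0.
    by move=> hT; apply/funext => s; apply: (hT [::]).
  rewrite !wedge_cons !h // wedge0l wedge0r !contr_gsign wedgeNl.
  by rewrite !mvE add0r addr0 addrN.
rewrite cat_cons wedge_cons !IH ?addr0 //.
- exact: adj_gsign.
- exact: adj_contr.
- exact: adj_contr.
Qed.

Let mlin_swap P s1 s2 a b : mlin P -> adj P ->
  P (s1 ++ a :: b :: s2) = - P (s1 ++ b :: a :: s2).
Proof.
move=> hP aP; apply/eqP; rewrite -addr_eq0; apply/eqP.
have L x y z t : P (s1 ++ (x + y) :: (z + t) :: s2) =
  P (s1 ++ x :: z :: s2) + P (s1 ++ x :: t :: s2)
  + (P (s1 ++ y :: z :: s2) + P (s1 ++ y :: t :: s2)).
  have := hP s1 ((z + t) :: s2) 1 x y; rewrite !scale1r !mul1r => ->.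
  have := hP (rcons s1 x) s2 1 z t; rewrite !cat_rcons !scale1r !mul1r => ->.
  by have := hP (rcons s1 y) s2 1 z t; rewrite !cat_rcons !scale1r !mul1r => ->.
by have := L a b a b; rewrite !aP add0r addr0.
Qed.

Let adj_uniq P s : mlin P -> adj P -> ~~ uniq s -> P s = 0.
Proof.
move=> hP aP; have H s2 s1 s3 x : P (s1 ++ x :: s2 ++ x :: s3) = 0.
  elim: s2 s1 => [|y s2 IH] s1; first exact: aP.
  by rewrite cat_cons mlin_swap // -cat_rcons IH oppr0.
rewrite -[P s]/(P ([::] ++ s)); move: [::] => s0; elim: s s0 => [//|x s IH] s0 /=.
rewrite negb_and negbK => /orP[xs|su]; last by rewrite -cat_rcons IH.
by case/splitPr: xs => s2 s3; apply: H.
Qed.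

Let kv_adj k P : is_kvector k P -> adj P.
Proof.
move=> [_ _ Pa] s1 s2 a; apply: Pa; rewrite cat_uniq /= inE eqxx /=.
by rewrite !andbF.
Qed.

Lemma kv_wedge k l P Q :
  is_kvector k P -> is_kvector l Q -> is_kvector (k + l) (wedge P Q).
Proof.
move=> hP hQ; have mP := kv_mlin hP; have mQ := kv_mlin hQ.
apply: kv_intro => [s||s].
- elim: s k l P Q hP hQ {mP mQ} => [|a s IH] k l P Q hP hQ skl.
    rewrite wedge_nil; case: k hP skl => [|k] hP skl.
      by rewrite (kvector_size hQ) ?mulr0.
    by rewrite (kvector_size hP) ?mul0r.
  have hgP : is_kvector k (gsign P) by rewrite (kv_parity hP); apply: kv_scale.
  rewrite wedge_cons.
  case: k hP hgP skl => [|k] hP hgP skl; case: l hQ skl => [|l] hQ skl.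
  + by rewrite !kv0_contr // wedge0l wedge0r addr0.
  + rewrite [contr a P]kv0_contr // wedge0l add0r (IH 0%N l) //.
      exact: kv_contr.
    by move=> /= e; apply: skl; rewrite /= e.
  + rewrite [contr a Q]kv0_contr // wedge0r addr0 (IH k 0%N) //.
      exact: kv_contr.
    by move=> /= e; apply: skl; rewrite /= e.
  + rewrite (IH k l.+1) ?(IH k.+1 l) ?addr0 //.
    * exact: kv_contr.
    * by move=> /= e; apply: skl; rewrite /= e addSnnS.
    * exact: kv_contr.
    * by move=> /= e; apply: skl; rewrite /= e.
- exact: mlin_wedge.
- by apply: adj_uniq; [apply: mlin_wedge|apply: adj_wedge; apply: kv_adj; eassumption].
Qed.

Lemma contrC k P a b : is_kvector k P -> contr a (contr b P) = - contr b (contr a P).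
Proof.
move=> hP; apply/funext => s; rewrite mvE.
by apply: (mlin_swap [::] s _ _ (kv_mlin hP)); apply: kv_adj hP.
Qed.

Lemma contr_expand k P a : is_kvector k P ->
  contr a P = \sum_i a (basis_vec i) *: contr (basis_covec i) P.
Proof.
move=> hP; apply/funext => s; rewrite mv_sumE.
have /= := linear_sumE (index_enum _) (fun i => a (basis_vec i))
  (@basis_covec _ _) (kvector_linear hP [::] s).
by rewrite -covec_expand.
Qed.

Lemma wedge_contr_basis k P : is_kvector k P ->
  \sum_i wedge (mv1 (basis_vec i)) (contr (basis_covec i) P) = k%:R *: P.
Proof.
move=> hP; apply/funext => s; elim: s k P hP => [|a s IH] k P hP.
  rewrite !mvE big1 => [|i _]; last by rewrite wedge_nil mul0r.
  by case: k hP => [|k] hP; rewrite ?mul0r // (kvector_size hP) ?mulr0.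
rewrite !mvE; case: k hP => [|k] hP.
  by rewrite mul0r big1 // => i _; rewrite kv0_contr // wedge0r mvE.
under eq_bigr => i _.
  rewrite wedge_cons contr_mv1 wedge_mv0l gsign_mv1 wedgeNl (contrC _ _ hP).
  rewrite wedgeNr opprK; over.
rewrite big_split /=.
have /(congr1 (fun T => T s)) := contr_expand a hP; rewrite mv_sumE => <-.
have := IH k _ (kv_contr a hP); rewrite mv_sumE => ->.
by rewrite mvE -[k.+1]add1n natrD mulrDl mul1r.
Qed.

End Kvectors.

Section Schouten.
Variable br : V -> V -> V.

Lemma schouten_linearlP Q : linear ((schouten br)^~ Q).
Proof.
move=> c P T; rewrite /schouten scaler_sumr -big_split; apply: eq_bigr => i _.
rewrite scaler_sumr -big_split; apply: eq_bigr => j _ /=.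
by rewrite !linearP wedgeDl wedgeZl wedgeDr wedgeZr opprD scalerN.
Qed.

Lemma schouten_linearrP P : linear (schouten br P).
Proof.
move=> c Q T; rewrite /schouten scaler_sumr -big_split; apply: eq_bigr => i _.
rewrite scaler_sumr -big_split; apply: eq_bigr => j _ /=.
rewrite linearP.
by rewrite !wedgeDr !wedgeZr opprD scalerN.
Qed.

Lemma kv_schouten k l P Q : is_kvector k P -> is_kvector l Q ->
  is_kvector (k + l).-1 (schouten br P Q).
Proof.
move=> hP hQ; apply: kv_sum => i; apply: kv_sum => j; rewrite contr_gsign.
rewrite wedgeNl wedgeNr opprK.
case: k hP => [|k] hP.
  by rewrite kv0_contr // linear0 wedge0l wedge0r; apply: kv_0.
case: l hQ => [|l] hQ.
  by rewrite [contr _ Q]kv0_contr // !wedge0r; apply: kv_0.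
rewrite addSn addnS -[(k + l).+1]add1n /=; apply: kv_wedge; first exact: kv_mv1.
apply: kv_wedge; last exact: kv_contr.
by rewrite (kv_parity (kv_contr _ hP)); apply: kv_scale; apply: kv_contr.
Qed.

Hypothesis br_lie : is_lie_bracket br.

Lemma lie_anti X Y : br X Y = - br Y X.
Proof.
case: br_lie => Ll Lr La _; apply/eqP; rewrite -addr_eq0; apply/eqP.
have := La (X + Y); have := Ll (X + Y) 1 X Y; rewrite !scale1r => ->.
have := Lr X 1 X Y; rewrite !scale1r => ->.
by have := Lr Y 1 X Y; rewrite !scale1r => ->; rewrite !La add0r addr0.
Qed.

Lemma schouten_rulesP : schouten_rules br (schouten br).
Proof.
case: (br_lie) => Ll Lr La _.
split; [exact: schouten_linearlP|exact: schouten_linearrP|..].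
- move=> X Y; rewrite {2}(vec_expand X) {2}(vec_expand Y).
  rewrite (linear_sumE _ _ _ (Ll _)) (linear_sumE _ _ _ mv1_linear).
  apply: eq_bigr => i _; rewrite (linear_sumE _ _ _ (Lr _)).
  rewrite (linear_sumE _ _ _ mv1_linear) scaler_sumr; apply: eq_bigr => j _.
  rewrite gsign_mv1 linearN /= !contr_mv1 wedgeNl wedge_mv0l wedgeNr opprK.
  by rewrite wedgeZr wedge_mv0r.
- move=> X c; rewrite /schouten big1 // => i _; rewrite big1 // => j _.
  by rewrite contr_mv0 !wedge0r oppr0.
- move=> k l P Q hP hQ; rewrite /schouten exchange_big scaler_sumr /=.
  apply: eq_bigr => j _; rewrite scaler_sumr; apply: eq_bigr => i _.
  rewrite [in LHS]lie_anti mv1N wedgeNl.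
  rewrite (kv_parity hP) (kv_parity hQ).
  have hi := parity_contr (basis_covec i) (kv_parity hP).
  have hj := parity_contr (basis_covec j) (kv_parity hQ).
  rewrite !contrZ !wedgeZl !wedgeZr.
  rewrite (wedgeC hi hj) !wedgeZr opprK !scalerN !scalerA -scaleNr.
  congr (_ *: _); rewrite -[RHS]mulN1r -!exprD -exprS; apply: sign_odd.
  by rewrite /= !(oddD, oddM) /=; case: (odd k); case: (odd l).
- move=> k l m P Q T hP hQ hT; rewrite /schouten wedge_suml wedge_sumr scaler_sumr.
  rewrite -big_split; apply: eq_bigr => i _.
  rewrite wedge_suml wedge_sumr scaler_sumr -big_split; apply: eq_bigr => j _ /=.
  rewrite contr_wedge !wedgeDr opprD !wedgeNl wedgeNr !wedgeA; congr (_ + _).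
  set b := mv1 _; set p := contr _ (gsign P); rewrite (kv_parity hQ).
  have hb : parity 1 b by exact: kv_parity (kv_mv1 _).
  have hp : parity k.+1 p.
    rewrite /p (kv_parity hP) contrZ.
    by apply: parityZ; apply: parity_contr; apply: kv_parity.
  rewrite wedgeZr wedgeZl -(wedgeA b p Q) (wedgeC hp (kv_parity hQ)) wedgeZr wedgeA.
  rewrite (wedgeC hb (kv_parity hQ)) !wedgeZl !scalerA !scalerN; congr (- (_ *: _)).
  rewrite -!exprD; apply: sign_odd.
  by rewrite !(oddD, oddM) /=; case: (odd k); case: (odd l).
Qed.

Lemma schouten_unique S k l P Q : schouten_rules br S ->
  is_kvector k P -> is_kvector l Q -> S P Q = schouten br P Q.
Proof.
move=> hS; move: schouten_rulesP; set S' := schouten br => hS'.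
have Z0 (f : mvec V -> mvec V) : linear f -> f 0 = 0.
  by move=> /(_ (-1) 0 0); rewrite scaler0 add0r scaleN1r addNr.
have lin (f : mvec V -> mvec V) c U : linear f -> f (c *: U) = c *: f U.
  by move=> lf; have := lf c U 0; rewrite !addr0 (Z0 f lf) addr0.
have extend i U : is_kvector i U ->
    (forall c, S U (mv0 c) = S' U (mv0 c)) ->
    (forall X, S U (mv1 X) = S' U (mv1 X)) ->
    forall j W, is_kvector j W -> S U W = S' U W.
  move=> hU h0 h1; elim=> [|j IH] W hW; first by rewrite (kv0E hW) h0.
  have -> : W = \sum_a (j.+1%:R)^-1 *:
      wedge (mv1 (basis_vec a)) (contr (basis_covec a) W).
    rewrite -scaler_sumr (wedge_contr_basis hW) scalerA mulVf ?scale1r //.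
    by rewrite pnatr_eq0.
  rewrite (linear_sumE _ _ _ (schouten_linearr hS U)).
  rewrite (linear_sumE _ _ _ (schouten_linearr hS' U)).
  apply: eq_bigr => a _; congr (_ *: _).
  have hc := kv_contr (basis_covec a) hW.
  rewrite (schouten_leibniz hS hU (kv_mv1 _) hc).
  by rewrite (schouten_leibniz hS' hU (kv_mv1 _) hc) h1 (IH _ hc).
have scal S1 : schouten_rules br S1 ->
    forall i U c, is_kvector i U -> S1 (mv0 c) U = 0.
  move=> h1; elim=> [|i IH] U c hU.
    rewrite (kv0E hU) [mv0 (U [::])]mv0Z (lin _ _ _ (schouten_linearr h1 _)).
    have := schouten_leibniz h1 (kv_mv0 c) (kv_mv0 1) (kv_mv0 1).
    rewrite !wedge_mv0l wedge_mv0r mul0n expr0 !scale1r => e.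
    suff -> : S1 (mv0 c) (mv0 1) = 0 by rewrite scaler0.
    by apply: (addrI (S1 (mv0 c) (mv0 1))); rewrite -e addr0.
  have -> : U = \sum_a (i.+1%:R)^-1 *:
      wedge (mv1 (basis_vec a)) (contr (basis_covec a) U).
    rewrite -scaler_sumr (wedge_contr_basis hU) scalerA mulVf ?scale1r //.
    by rewrite pnatr_eq0.
  rewrite (linear_sumE _ _ _ (schouten_linearr h1 _)).
  rewrite big1 // => a _; have hc := kv_contr (basis_covec a) hU.
  rewrite (schouten_leibniz h1 (kv_mv0 c) (kv_mv1 _) hc) (IH _ _ hc).
  rewrite (schouten_sym h1 (kv_mv0 c) (kv_mv1 _)) (schouten_scal h1).
  by rewrite scaler0 wedge0l wedge0r scaler0 addr0 scaler0.
have vec X j W : is_kvector j W -> S (mv1 X) W = S' (mv1 X) W.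
  apply: (extend 1%N _ (kv_mv1 X)) => [c|Y].
    by rewrite (schouten_scal hS) (schouten_scal hS').
  by rewrite (schouten_br hS) (schouten_br hS').
move=> hP hQ; apply: (extend k P hP _ _ l Q hQ) => [c|X].
  rewrite (schouten_sym hS hP (kv_mv0 c)) (schouten_sym hS' hP (kv_mv0 c)).
  by rewrite (scal S hS _ _ c hP) (scal S' hS' _ _ c hP).
rewrite (schouten_sym hS hP (kv_mv1 X)) (schouten_sym hS' hP (kv_mv1 X)).
by rewrite (vec X k P hP).
Qed.

End Schouten.

Lemma ce_diff1 brs X a b : ce_diff brs (mv1 X) [:: a; b] = - brs a b X.
Proof.
by rewrite /ce_diff /= !big_ord_recl !big_ord0 /= add0r !addr0 expr1 mulN1r.
Qed.

Lemma sharpE r a b : is_kvector 2 r -> b (sharp r a) = r [:: a; b].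
Proof.
move=> hr; rewrite /sharp linear_sum /= [in RHS](covec_expand b).
have := linear_sumE (index_enum _) (fun i => b (basis_vec i))
  (@basis_covec _ _) (kvector_linear hr [:: a] [::]); rewrite /= => ->.
by apply: eq_bigr => i _; rewrite linearZ /= [LHS]mulrC.
Qed.

Lemma coadE br X a Y : is_lie_bracket br -> coad br X a Y = - a (br X Y).
Proof.
move=> [_ Lr _ _]; have L : linear ((fun Y => - a (br X Y)) : V -> R^o).
  by move=> c Z W; rewrite Lr linearP opprD scalerN.
pose f : {linear V -> R^o} := HB.pack ((fun Y => - a (br X Y)) : V -> R^o)
  (GRing.isLinear.Build R V R^o _ _ L).
exact: (lfunE f).
Qed.

End MultivectorTheory.

Section ExtensionTheory.
Variables (R : realType) (h : vectType R).
Implicit Types (a b : {dual h}) (l : R) (u : {dual (h * R^o)%type}).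

Lemma ext_covecE a l (A : h * R^o) : ext_covec a l A = (a A.1 : R) + l * A.2.
Proof.
have L : linear ((fun A => a A.1 + l * A.2) : h * R^o -> R^o).
  by move=> c [X x] [Y y]; rewrite /= linearP scalerDr mulrDr addrACA
       [l * _]mulrCA.
pose f : {linear (h * R^o)%type -> R^o} :=
  HB.pack ((fun A => a A.1 + l * A.2) : h * R^o -> R^o)
  (GRing.isLinear.Build R (h * R^o)%type R^o _ _ L).
exact: (lfunE f).
Qed.

Lemma covec_fstE u X : covec_fst u X = u (X, 0).
Proof.
have L : linear ((fun X => u (X, 0)) : h -> R^o).
  by move=> c Y Z; rewrite -linearP; congr (u (_, _)); rewrite /= scaler0 addr0.
pose f : {linear h -> R^o} := HB.pack ((fun X => u (X, 0)) : h -> R^o)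
  (GRing.isLinear.Build R h R^o _ _ L).
exact: (lfunE f).
Qed.

Lemma ext_covecK a l :
  covec_fst (ext_covec a l) = a /\ covec_snd (ext_covec a l) = l.
Proof.
split; last by rewrite /covec_snd ext_covecE linear0 add0r mulr1.
by apply/lfunP => X; rewrite covec_fstE ext_covecE mulr0 addr0.
Qed.

Lemma covecK u : ext_covec (covec_fst u) (covec_snd u) = u.
Proof.
apply/lfunP => -[X x]; rewrite ext_covecE covec_fstE /covec_snd /=.
have -> : (X, x) = x *: ((0, 1) : h * R^o) + (X, 0).
  by congr (_, _); rewrite /= ?scaler0 ?add0r // addr0 [RHS]mulr1.
by rewrite linearP addrC; congr (_ + _); apply: mulrC.
Qed.

End ExtensionTheory.

(* Main.v *)
Require Import Defs.
From mathcomp Require Import all_boot all_order all_algebra.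
From mathcomp Require Import boolp functions reals.
From mathcomp Require Import ring zify.

Set Implicit Arguments.
Unset Strict Implicit.
Unset Printing Implicit Defensive.
Import GRing.Theory Num.Theory.

(* Write S = #_r and rho(a, l) = S a + l X0. The two hypotheses on r say that
   a[Sb, Sc] + a(X0) c(Sb) summed cyclically over (a, b, c) is 0 and that
   a[X0, Sb] is symmetric in (a, b). They imply that rho maps the bracket of g^*
   to that of h and that X0 vanishes on brackets, after which the Jacobi
   identity is formal. For the compatibility, the twisted differential of A in g
   is - [A, P]_phi0 for a fixed bivector P, so that the condition reduces to the
   Jacobi identity of g. *)

Local Open Scope ring_scope.

(* The values of covectors lie in R^o; ev retypes them in R, where the ring
   tactic recognizes the operations. *)
Definition ev (R : realType) (V : vectType R) (a : {dual V}) (X : V) : R := a X.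

(** * Evaluation of covectors on vectors *)

Section Evaluation.
Variables (R : realType) (V : vectType R).
Implicit Types (a b : {dual V}) (X Y : V).

Lemma ev_ext a b : (forall X, ev a X = ev b X) -> a = b.
Proof. by move=> e; apply/lfunP. Qed.

Lemma evDl a b X : ev (a + b) X = ev a X + ev b X.
Proof. by rewrite /ev add_lfunE. Qed.
Lemma evNl a X : ev (- a) X = - ev a X.
Proof. by rewrite /ev opp_lfunE. Qed.
Lemma evZl c a X : ev (c *: a) X = c * ev a X.
Proof. by rewrite /ev scale_lfunE. Qed.
Lemma ev0l X : ev 0 X = 0.
Proof. by rewrite /ev zero_lfunE. Qed.
Lemma evDr a X Y : ev a (X + Y) = ev a X + ev a Y.
Proof. by rewrite /ev linearD. Qed.
Lemma evNr a X : ev a (- X) = - ev a X.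
Proof. by rewrite /ev linearN. Qed.
Lemma evZr c a X : ev a (c *: X) = c * ev a X.
Proof. by rewrite /ev linearZ. Qed.
Lemma ev0r a : ev a 0 = 0.
Proof. by rewrite /ev linear0. Qed.

Definition evE := (evDl, evNl, evZl, ev0l, evDr, evNr, evZr, ev0r).

Lemma ev_sumr I (s : seq I) (p : pred I) (F : I -> V) a :
  ev a (\sum_(i <- s | p i) F i) = \sum_(i <- s | p i) ev a (F i).
Proof. by rewrite /ev linear_sum. Qed.

Lemma ev_separates X Y : (forall a, ev a X = ev a Y) -> X = Y.
Proof.
move=> e; rewrite (vec_expand X) (vec_expand Y); apply: eq_bigr => i _.
by congr (_ *: _); apply: e.
Qed.

Lemma ev_expand_vec X : X = \sum_i ev (basis_covec i) X *: basis_vec i.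
Proof. exact: vec_expand. Qed.

End Evaluation.

(** * Lie brackets and the coadjoint representation *)

Section LieBracket.
Variables (R : realType) (V : vectType R) (br : V -> V -> V).
Hypothesis br_lie : is_lie_bracket br.

Lemma lieDl X Y Z : br (X + Y) Z = br X Z + br Y Z.
Proof. by have := lie_linearl br_lie Z 1 X Y; rewrite !scale1r. Qed.
Lemma lieDr X Y Z : br Z (X + Y) = br Z X + br Z Y.
Proof. by have := lie_linearr br_lie Z 1 X Y; rewrite !scale1r. Qed.
Lemma lie0l X : br 0 X = 0.
Proof. by apply: (addrI (br 0 X)); rewrite -lieDl !addr0. Qed.
Lemma lie0r X : br X 0 = 0.
Proof. by apply: (addrI (br X 0)); rewrite -lieDr !addr0. Qed.
Lemma lieZl c X Z : br (c *: X) Z = c *: br X Z.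
Proof. by have := lie_linearl br_lie Z c X 0; rewrite lie0l !addr0. Qed.
Lemma lieZr c X Z : br Z (c *: X) = c *: br Z X.
Proof. by have := lie_linearr br_lie Z c X 0; rewrite lie0r !addr0. Qed.
Lemma lieNl X Z : br (- X) Z = - br X Z.
Proof. by rewrite -scaleN1r lieZl scaleN1r. Qed.
Lemma lieNr X Z : br Z (- X) = - br Z X.
Proof. by rewrite -scaleN1r lieZr scaleN1r. Qed.

(** The Jacobi identity as a rewriting rule: once it has removed every bracket nested on the left,
    [ring] can match the remaining terms. *)
Lemma lie_brl X Y Z : br (br X Y) Z = br X (br Y Z) - br Y (br X Z).
Proof.
have := lie_jacobi br_lie X Y Z.
rewrite (lie_anti br_lie Z (br X Y)) (lie_anti br_lie Z X) lieNr => e.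
by apply/esym/eqP; rewrite -subr_eq0; apply/eqP.
Qed.

Lemma lie_suml I (s : seq I) (p : pred I) (c : I -> R) (F : I -> V) Z :
  br (\sum_(i <- s | p i) c i *: F i) Z = \sum_(i <- s | p i) c i *: br (F i) Z.
Proof.
by elim/big_rec2: _ => [|i y x _ <-]; rewrite ?lie0l // lieDl lieZl.
Qed.
Lemma lie_sumr I (s : seq I) (p : pred I) (c : I -> R) (F : I -> V) Z :
  br Z (\sum_(i <- s | p i) c i *: F i) = \sum_(i <- s | p i) c i *: br Z (F i).
Proof.
by elim/big_rec2: _ => [|i y x _ <-]; rewrite ?lie0r // lieDr lieZr.
Qed.

Lemma ev_coad X a Y : ev (coad br X a) Y = - ev a (br X Y).
Proof. exact: coadE. Qed.

Lemma coad_br X Y a :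
  coad br (br X Y) a = coad br X (coad br Y a) - coad br Y (coad br X a).
Proof.
by apply: ev_ext => Z; rewrite !evE !ev_coad lie_brl !evE; ring.
Qed.

End LieBracket.

(** * Bivectors and their Schouten brackets *)

Section Bivectors.
Variables (R : realType) (V : vectType R).
Implicit Types (P Q : mvec V) (a b c : {dual V}).

Lemma bivector_eq P Q : is_kvector 2 P -> is_kvector 2 Q ->
  (forall a b, P [:: a; b] = Q [:: a; b]) -> P = Q.
Proof.
move=> hP hQ e; apply/funext => s; have [] := eqVneq (size s) 2%N.
  by case: s => [|a [|b []]] // _; apply: e.
by move=> /eqP s2; rewrite (kvector_size hP) // (kvector_size hQ).
Qed.

Section Bilinear.
Variable P : mvec V.
Hypothesis P2 : is_kvector 2 P.

Lemma bivDl a b c : P [:: a + b; c] = P [:: a; c] + P [:: b; c].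
Proof. by have := kv_mlin P2 [::] [:: c] 1 a b; rewrite /= scale1r mul1r. Qed.
Lemma bivDr a b c : P [:: c; a + b] = P [:: c; a] + P [:: c; b].
Proof. by have := kv_mlin P2 [:: c] [::] 1 a b; rewrite /= scale1r mul1r. Qed.
Lemma biv0l a : P [:: 0; a] = 0.
Proof. by apply: (addrI (P [:: 0; a])); rewrite -bivDl !addr0. Qed.
Lemma biv0r a : P [:: a; 0] = 0.
Proof. by apply: (addrI (P [:: a; 0])); rewrite -bivDr !addr0. Qed.
Lemma bivZl k a c : P [:: k *: a; c] = k * P [:: a; c].
Proof. by have := kv_mlin P2 [::] [:: c] k a 0; rewrite /= biv0l !addr0. Qed.
Lemma bivZr k a c : P [:: c; k *: a] = k * P [:: c; a].
Proof. by have := kv_mlin P2 [:: c] [::] k a 0; rewrite /= biv0r !addr0. Qed.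

Lemma bivC a b : P [:: a; b] = - P [:: b; a].
Proof.
by have /(congr1 (fun T => T [::])) := contrC b a P2; rewrite mvE.
Qed.

Lemma biv_suml I (s : seq I) (k : I -> R) (F : I -> {dual V}) c :
  P [:: \sum_(i <- s) k i *: F i; c] = \sum_(i <- s) k i * P [:: F i; c].
Proof. by elim/big_rec2: _ => [|i y x _ <-]; rewrite ?biv0l // bivDl bivZl. Qed.

Lemma ev_sharp a b : ev b (sharp P a) = P [:: a; b].
Proof. exact: sharpE. Qed.

Lemma sharpD a b : sharp P (a + b) = sharp P a + sharp P b.
Proof. by apply: ev_separates => c; rewrite evE !ev_sharp bivDl. Qed.
Lemma sharpZ k a : sharp P (k *: a) = k *: sharp P a.
Proof. by apply: ev_separates => c; rewrite evE !ev_sharp bivZl. Qed.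

(** Reduces the Schouten brackets below to wedges of vectors, which [wedge11] evaluates. *)
Lemma contr_bivector a : contr a P = mv1 (sharp P a).
Proof.
apply/funext => -[|b [|c s]] /=; rewrite /contr; last 1 first.
- by rewrite (kvector_size P2).
- by rewrite (kvector_size P2).
- by rewrite -ev_sharp.
Qed.

Lemma schouten_vec br X Q : is_lie_bracket br ->
  schouten br (mv1 X) Q =
    \sum_j wedge (mv1 (br X (basis_vec j))) (contr (basis_covec j) Q).
Proof.
move=> br_lie; rewrite /schouten exchange_big; apply: eq_bigr => j _.
rewrite {2}(vec_expand X) lie_suml // (linear_sumE _ _ _ (@mv1_linear _ _)).
rewrite wedge_suml; apply: eq_bigr => i _.
by rewrite gsign_mv1 linearN /= contr_mv1 wedgeNl wedge_mv0l wedgeNr opprK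
  wedgeZr wedgeZl.
Qed.

(** X acts on bivectors as a derivation, and [coad] is dual to the bracket: the sum over the dual
    basis reassembles the covectors [coad br X a] and [coad br X b]. *)
Lemma schouten_vec_biv br X a b : is_lie_bracket br ->
  schouten br (mv1 X) P [:: a; b] =
    - (P [:: coad br X a; b] + P [:: a; coad br X b]).
Proof.
move=> br_lie.
have E u v : \sum_j ev u (br X (basis_vec j)) * P [:: basis_covec j; v] =
    - P [:: coad br X u; v].
  rewrite (covec_expand (coad br X u)) biv_suml -sumrN; apply: eq_bigr => j _.
  by rewrite -/(ev _ _) ev_coad // mulNr opprK.
rewrite opprD [P [:: a; _]]bivC opprK -E -[P [:: coad br X b; a]]opprK -E.
rewrite schouten_vec // mv_sumE -sumrN -big_split; apply: eq_bigr => j _ /=.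
rewrite contr_bivector wedge11 -!/(ev _ _) !ev_sharp; ring.
Qed.

(** The triple wedge gives six determinant-like terms; antisymmetry of [br] makes them equal in
    pairs, whence the factor 2. *)
Lemma schouten_biv_biv br a b c : is_lie_bracket br ->
  let S := sharp P in
  schouten br P P [:: a; b; c] =
    - 2%:R * (ev a (br (S b) (S c)) + ev b (br (S c) (S a))
              + ev c (br (S a) (S b))).
Proof.
move=> br_lie S.
(* Resummation over the dual basis: skewness of [P] turns each sum into minus a sharp, and the two
   signs cancel. *)
have E u v w : \sum_i \sum_j ev u (br (basis_vec i) (basis_vec j))
    * (ev v (S (basis_covec i)) * ev w (S (basis_covec j))) =
    ev u (br (S v) (S w)).
  rewrite (ev_expand_vec (S v)) lie_suml // ev_sumr; apply: eq_bigr => i _.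
  rewrite (ev_expand_vec (S w)) lie_sumr // evZr.
  rewrite [ev u (\sum_(_ <- _) _)]ev_sumr mulr_sumr.
  apply: eq_bigr => j _ /=; rewrite evZr !ev_sharp.
  by rewrite [P [:: basis_covec i; v]]bivC [P [:: basis_covec j; w]]bivC; ring.
have A u v w : ev u (br (S v) (S w)) = - ev u (br (S w) (S v)).
  by rewrite (lie_anti br_lie) evNr.
transitivity (ev a (br (S c) (S b)) - ev a (br (S b) (S c))
  + (ev b (br (S a) (S c)) - ev b (br (S c) (S a)))
  + (ev c (br (S b) (S a)) - ev c (br (S a) (S b)))); last first.
  by rewrite (A a c) (A b a) (A c b); ring.
rewrite -!E -!sumrB -!big_split /schouten mv_sumE; apply: eq_bigr => i _ /=.
rewrite -!sumrB -!big_split mv_sumE; apply: eq_bigr => j _ /=.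
rewrite mvE contr_gsign !contr_bivector gsign_mv1 opprK wedge_cons.
rewrite contr_mv1 gsign_mv1 wedge_mv0l mvE wedge11 contr_wedge.
rewrite !contr_mv1 gsign_mv1 !wedgeNl !wedge_mv0l !wedge_mv0r.
rewrite wedgeDr wedgeNr !wedgeZr !mvE !wedge11 -!/(ev _ _); ring.
Qed.

End Bilinear.
End Bivectors.

(** * The differential of a vector is a bivector *)

Lemma size_delete (R : realType) (V : vectType R) i (s : seq {dual V}) :
  (i < size s)%N -> size (delete i s) = (size s).-1.
Proof. by move=> si; rewrite size_cat size_take si size_drop; lia. Qed.

Lemma kv_ce_diff1 (R : realType) (V : vectType R) brs (X : V) :
  is_lie_bracket brs -> is_kvector 2 (ce_diff brs (mv1 X)).
Proof.
move=> brs_lie.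
have sz s : size s <> 2%N -> ce_diff brs (mv1 X) s = 0.
  move=> s2; rewrite /ce_diff big1 // => j _; rewrite big1 // => i _.
  (* [mv1 X] sees the bracket followed by [t], so a nonzero term needs [t] empty; [t] is [s] with
     two entries removed. *)
  set t := delete _ _; suff : size t <> 0%N.
    by case: t => // a t _; rewrite mulr0.
  have := ltn_ord i; have := ltn_ord j => lj li.
  have sj := size_delete lj; have li' : (i < size (delete j s))%N by lia.
  by rewrite /t (size_delete li'); lia.
apply: kv_intro => // [s1 s2 c a b|s].
  have [e|/eqP ne] := eqVneq (size s1 + size s2)%N 1%N; last first.
    have sz' d : size (s1 ++ d :: s2) <> 2%N.
      by rewrite size_cat /= addnS => -[].
    by rewrite !(sz _ (sz' _)) mulr0 addr0.
  case: s1 s2 e => [|d [|? ?]] [|d' [|? ?]] //= _;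
    rewrite ?ce_diff1 -!/(ev _ _).
    by rewrite lieDl // lieZl // !evE; ring.
  by rewrite lieDr // lieZr // !evE; ring.
have [|/eqP/sz//] := eqVneq (size s) 2%N.
case: s => [|a [|b []]] //= _; rewrite inE andbT negbK => /eqP->.
by rewrite ce_diff1 (lie_alt brs_lie) -/(ev _ _) ev0l oppr0.
Qed.

(** * Covectors on the product of h with R *)

Section ExtensionDual.
Variables (R : realType) (h : vectType R).
Local Notation g := (h * R^o)%type.
Implicit Types (u v w : {dual g}) (X : h) (x : R).

Lemma ev_ext_covec (a : {dual h}) (l : R) (A : g) :
  ev (ext_covec a l) A = ev a A.1 + l * A.2.
Proof. exact: ext_covecE. Qed.

Lemma ev_pair u (A : g) : ev u A = ev (covec_fst u) A.1 + covec_snd u * A.2.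
Proof. by rewrite -{1}[u]covecK ev_ext_covec. Qed.

Lemma covec_fstK (a : {dual h}) (l : R) : covec_fst (ext_covec a l) = a.
Proof. by case: (ext_covecK a l). Qed.
Lemma covec_sndK (a : {dual h}) (l : R) : covec_snd (ext_covec a l) = l.
Proof. by case: (ext_covecK a l). Qed.

Lemma covec_fstD u v : covec_fst (u + v) = covec_fst u + covec_fst v.
Proof.
by apply/lfunP => X; rewrite covec_fstE !add_lfunE /= !covec_fstE.
Qed.
Lemma covec_fstZ (c : R) u : covec_fst (c *: u) = c *: covec_fst u.
Proof.
by apply/lfunP => X; rewrite covec_fstE !scale_lfunE /= !covec_fstE.
Qed.
Lemma covec_sndD u v : covec_snd (u + v) = covec_snd u + covec_snd v.
Proof. by rewrite /covec_snd add_lfunE. Qed.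
Lemma covec_sndZ (c : R) u : covec_snd (c *: u) = c * covec_snd u.
Proof. by rewrite /covec_snd scale_lfunE. Qed.

End ExtensionDual.

(** * The bracket on the dual *)

Section StarBracket.
Variables (R : realType) (h : vectType R) (br : h -> h -> h) (r : mvec h).
Variable X0 : h.
Hypotheses (br_lie : is_lie_bracket br) (r2 : is_kvector 2 r).
Local Notation g := (h * R^o)%type.
Local Notation S := (sharp r).
Local Notation star := (star_bracket br r X0).
Implicit Types (a b c : {dual h}) (u v w : {dual g}) (Y : h).

Let lieE := (lieDl br_lie, lieDr br_lie, lieZl br_lie, lieZr br_lie, evE).

(** The map rho above. It absorbs the terms in [coad br X0], so that the first component of
    [star u v] is coad along [anchor u] of v minus coad along [anchor v] of u, up to the contraction
    by [X0]. *)
Definition anchor u : h := S (covec_fst u) + covec_snd u *: X0.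

Lemma anchorD u v : anchor (u + v) = anchor u + anchor v.
Proof.
by rewrite /anchor covec_fstD covec_sndD sharpD // scalerDl addrACA.
Qed.
Lemma anchorZ (k : R) u : anchor (k *: u) = k *: anchor u.
Proof.
by rewrite /anchor covec_fstZ covec_sndZ sharpZ // scalerDr scalerA.
Qed.

Lemma ev_star_fst u v Y :
  ev (covec_fst (star u v)) Y =
    ev (covec_fst u) (br (anchor v) Y) - ev (covec_fst v) (br (anchor u) Y)
    - ev (covec_fst u) X0 * ev (covec_fst v) Y
    + ev (covec_fst v) X0 * ev (covec_fst u) Y.
Proof.
rewrite covec_fstK -!/(ev _ _) !evE !ev_coad // /anchor !lieE.
ring.
Qed.

Lemma star_snd u v :
  covec_snd (star u v) = - ev (covec_fst v) (S (covec_fst u)).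
Proof. by rewrite covec_sndK ev_sharp. Qed.

Lemma ev_star u v (A : g) :
  ev (star u v) A =
    ev (covec_fst u) (br (anchor v) A.1) - ev (covec_fst v) (br (anchor u) A.1)
    - ev (covec_fst u) X0 * ev (covec_fst v) A.1
    + ev (covec_fst v) X0 * ev (covec_fst u) A.1
    - ev (covec_fst v) (S (covec_fst u)) * A.2.
Proof. by rewrite ev_pair ev_star_fst star_snd mulNr. Qed.

Lemma sharpC a b : ev b (S a) = - ev a (S b).
Proof. by rewrite !ev_sharp // bivC. Qed.

(** * Consequences of the two equations on r; Jacobi identity on the dual *)

Hypothesis r_X0 : schouten br r r - 2%:R *: wedge (mv1 X0) r = 0.
Hypothesis X0_r : schouten br (mv1 X0) r = 0.

Lemma r_X0_cyclic a b c :
  ev a (br (S b) (S c)) + ev b (br (S c) (S a)) + ev c (br (S a) (S b))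
  + ev a X0 * ev c (S b) + ev b X0 * ev a (S c) + ev c X0 * ev b (S a) = 0.
Proof.
have /eqP := congr1 (fun P => P [:: a; b; c]) r_X0.
rewrite !mvE schouten_biv_biv // wedge_cons contr_mv1 gsign_mv1 wedge_mv0l.
rewrite contr_bivector // !mvE wedgeNl mvE wedge11 -!/(ev _ _) -!ev_sharp //.
move=> /eqP e.
(* Both terms of the hypothesis carry the factor -2, which is cancelled. *)
apply: (mulfI (x := - 2%:R)); first by rewrite oppr_eq0 pnatr_eq0.
by rewrite mulr0 -[RHS]e (sharpC a c); ring.
Qed.

(** Invariance of [r] under [X0] evaluated on (a, b): skewness of [r] turns a vanishing sum into a
    symmetry. *)
Lemma X0_sharp a b : ev a (br X0 (S b)) = ev b (br X0 (S a)).
Proof.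
have := congr1 (fun P => P [:: a; b]) X0_r.
rewrite schouten_vec_biv // mvE -!ev_sharp // (sharpC _ b) !ev_coad //.
move=> e; apply/eqP; rewrite -subr_eq0 -[X in _ == X]oppr0 -e; apply/eqP.
ring.
Qed.

(** The two products of values at [X0] cancel, and [X0_sharp] cancels the bracket terms. This is the
    cocycle condition on the dual. *)
Lemma star_X0 u v : ev (covec_fst (star u v)) X0 = 0.
Proof.
rewrite ev_star_fst /anchor !lieE (lie_alt br_lie) !(lie_anti br_lie _ X0).
rewrite !evE X0_sharp; ring.
Qed.

(** Tested on a covector c: [r_X0_cyclic] yields the bracket of the sharps, and [X0_sharp] the mixed
    terms with [X0]. *)
Lemma anchor_star u v : anchor (star u v) = br (anchor u) (anchor v).
Proof.
apply: ev_separates => c.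
rewrite {1}/anchor evDr evZr star_snd sharpC ev_star_fst /anchor.
set a := covec_fst u; set b := covec_fst v.
rewrite !lieE (lie_alt br_lie) ev0r.
rewrite !(lie_anti br_lie _ X0) !evE.
have := r_X0_cyclic a b c; rewrite (lie_anti br_lie (S c)) evE.
rewrite (sharpC b c) (X0_sharp c a) (X0_sharp c b) => e.
rewrite -[LHS]addr0 -[X in _ + X]e; ring.
Qed.

(** The R-component of the Jacobi identity for [star]. The terms in [br X0] cancel by symmetry, and
    the rest is twice [r_X0_cyclic]. *)
Lemma star_sharp_cyclic u v w :
  ev (covec_fst (star v w)) (S (covec_fst u)) =
    - ev (covec_fst (star w u)) (S (covec_fst v))
    - ev (covec_fst (star u v)) (S (covec_fst w)).
Proof.
rewrite !ev_star_fst /anchor !lieE.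
set a := covec_fst u; set b := covec_fst v; set c := covec_fst w.
have := r_X0_cyclic a b c.
rewrite (X0_sharp b a) (X0_sharp c a) (X0_sharp c b).
rewrite (lie_anti br_lie (S b) (S a)) (lie_anti br_lie (S c) (S b)).
rewrite (lie_anti br_lie (S a) (S c)) !evE.
rewrite (sharpC a b) (sharpC a c) (sharpC b c) => e.
apply/eqP; rewrite -subr_eq0 -(mulr0 2) -e; apply/eqP; ring.
Qed.

Lemma star_lie : is_lie_bracket star.
Proof.
split.
- move=> v k u w; apply: ev_ext => A.
  rewrite !evE !ev_star !covec_fstD !covec_fstZ !anchorD !anchorZ.
  rewrite !sharpD // !sharpZ // !lieE; ring.
- move=> v k u w; apply: ev_ext => A.
  rewrite !evE !ev_star !covec_fstD !covec_fstZ !anchorD !anchorZ.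
  rewrite !lieE; ring.
- move=> u; apply: ev_ext => A; rewrite ev_star ev0l ev_sharp //.
  have -> : r [:: covec_fst u; covec_fst u] = 0.
    by apply: (kvector_alt r2); rewrite /= inE eqxx.
  ring.
(* Since [anchor] preserves brackets and [X0] vanishes on them, the h-part follows from the Jacobi
   identity of [br]. *)
- move=> u v w; apply: ev_ext => A.
  rewrite !evE !(ev_star _ (star _ _)) star_sharp_cyclic !star_X0 !anchor_star.
  rewrite !ev_star_fst !(lie_brl br_lie) !evE; ring.
Qed.

(** * The pairing by P = r + (0, 1) /\ (X0, 0), and the compatibility condition *)

Definition star_form u v : R :=
  ev (covec_fst v) (S (covec_fst u)) + covec_snd u * ev (covec_fst v) X0
  - covec_snd v * ev (covec_fst u) X0.

Lemma star_formDl u v w : star_form (u + v) w = star_form u w + star_form v w.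
Proof.
by rewrite /star_form covec_fstD covec_sndD sharpD // !evE; ring.
Qed.
Lemma star_formNl u w : star_form (- u) w = - star_form u w.
Proof.
rewrite -scaleN1r /star_form covec_fstZ covec_sndZ sharpZ // !evE; ring.
Qed.
Lemma star_formC u v : star_form u v = - star_form v u.
Proof. by rewrite /star_form sharpC; ring. Qed.
Lemma star_formDr u v w : star_form w (u + v) = star_form w u + star_form w v.
Proof. by rewrite star_formC star_formDl opprD -!(star_formC w). Qed.
Lemma star_formNr u w : star_form w (- u) = - star_form w u.
Proof. by rewrite star_formC star_formNl -(star_formC w). Qed.

Lemma ext_bracket_lie : is_lie_bracket (ext_bracket br).
Proof.
split=> [Y k X Z|X k Y Z|X|X Y Z]; rewrite /ext_bracket /=.
- by congr (_, _); rewrite /= ?lieE // scaler0 addr0.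
- by congr (_, _); rewrite /= ?lieE // scaler0 addr0.
- by rewrite (lie_alt br_lie).
- by congr (_, _); rewrite /= ?(lie_jacobi br_lie) // !addr0.
Qed.

Local Notation C := (coad (ext_bracket br)).

(** The factor R is central and brackets have no component along it. *)
Lemma coad_ext (A : g) u : C A u = ext_covec (coad br A.1 (covec_fst u)) 0.
Proof.
apply: ev_ext => B; rewrite (ev_coad ext_bracket_lie) ev_pair ev_ext_covec.
by rewrite (ev_coad br_lie) /= mulr0 mul0r !addr0.
Qed.

Lemma kv_ce_diff_tw1 (A : g) : is_kvector 2 (ce_diff_tw star (- X0, 0) (mv1 A)).
Proof.
rewrite /ce_diff_tw -[ce_diff _ _]scale1r; apply: kv_lin.
  exact: kv_ce_diff1 star_lie.
exact: (@kv_wedge _ _ 1 1) (kv_mv1 _) (kv_mv1 _).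
Qed.

(* With P = r + (0, 1) /\ (X0, 0), whose values are given by star_form, this
   says d_*X A = - [A, P] + phi0(A) P, i.e. the twisted differential is the
   phi0-twisted coboundary of P. *)
Lemma ce_diff_tw_star (A : g) u v :
  ce_diff_tw star (- X0, 0) (mv1 A) [:: u; v] =
    star_form (C A u) v + star_form u (C A v) + A.2 * star_form u v.
Proof.
rewrite /ce_diff_tw mvE ce_diff1 wedge11 -!/(ev _ _) ev_star !ev_pair /=.
rewrite !coad_ext /star_form !covec_fstK !covec_sndK.
rewrite [ev (covec_fst v) (S (coad _ _ _))]sharpC !(ev_coad br_lie) /anchor.
rewrite !lieE !(lie_anti br_lie _ A.1) !evE.
ring.
Qed.

Lemma star_compat (A B : g) :
  ce_diff_tw star (- X0, 0) (mv1 (ext_bracket br A B)) =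
    schouten_phi (ext_bracket br) (ext_covec 0 1) 1 2 (mv1 A)
      (ce_diff_tw star (- X0, 0) (mv1 B))
    - schouten_phi (ext_bracket br) (ext_covec 0 1) 1 2 (mv1 B)
        (ce_diff_tw star (- X0, 0) (mv1 A)).
Proof.
(* In degrees 1 and 2 the coefficients k - 1 and l - 1 are 0 and 1, and phi0(D) is [D.2]. *)
have E (D : g) P : schouten_phi (ext_bracket br) (ext_covec 0 1) 1 2 (mv1 D) P =
    - D.2 *: P + schouten (ext_bracket br) (mv1 D) P.
  rewrite /schouten_phi contr_mv1 wedge_mv0l -/(ev _ _) ev_ext_covec ev0l.
  rewrite subrr mulr0 scale0r addr0 add0r mul1r scaleNr addrC; congr (- _ + _).
  by rewrite -[2%:R]/(1 + 1) addrK scale1r.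
rewrite !E; apply: bivector_eq => [||u v].
- exact: kv_ce_diff_tw1.
- rewrite addrC -scaleN1r; apply: kv_lin; apply: kv_lin;
    do ?exact: kv_ce_diff_tw1; exact: kv_schouten (kv_mv1 _) (kv_ce_diff_tw1 _).
rewrite !mvE !schouten_vec_biv;
  do ?[exact: kv_ce_diff_tw1|exact: ext_bracket_lie].
(* [coad_br] gives the commutator of the actions of A and B. Terms with one action on each argument
   are symmetric in A and B and drop out, and the R-component of the bracket is 0. *)
rewrite !ce_diff_tw_star !(coad_br ext_bracket_lie) /=.
rewrite !(star_formDl, star_formDr, star_formNl, star_formNr); ring.
Qed.

End StarBracket.

(** * Verification of the axioms *)

Theorem proposition6p3 (R : realType) (h : vectType R) (br : h -> h -> h)
  (r : mvec h) (X0 : h) (br_lie : is_lie_bracket br) (r2 : is_kvector 2 r)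
  (r_X0 : schouten br r r - 2%:R *: wedge (mv1 X0) r = 0)
  (X0_r : schouten br (mv1 X0) r = 0) :
  gen_lie_bialgebra (ext_bracket br) (ext_covec 0 1)
    (star_bracket br r X0) (- X0, 0).
Proof.
have g_lie := ext_bracket_lie br_lie.
have s_lie := star_lie br_lie r2 r_X0 X0_r.
split=> //.
- by move=> A B; rewrite ext_covecE lfunE /= mulr0 addr0.
- move=> u v; rewrite -/(ev _ _) ev_pair /= evNr star_X0 // oppr0 mulr0.
  exact: addr0.
- exact: star_compat.
- by rewrite ext_covecE lfunE /= mulr0 addr0.
move=> A; rewrite (schouten_br (schouten_rulesP g_lie)).
apply/funext => -[|u [|v s]]; rewrite mvE /contr.
- by rewrite (kvector_size (kv_ce_diff1 _ s_lie)) ?addr0.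
(* Only lists of length one matter. As phi0 = (0, 1) has anchor [X0], the contraction is u([X0, A]),
   opposite to the bracket with (-X0, 0). *)
- rewrite ce_diff1 /= -!/(ev _ _) ev_star // !ev_pair /= covec_fstK /anchor.
  have S0 : sharp r 0 = 0 by rewrite -(scale0r 0) sharpZ // scale0r.
  rewrite covec_fstK covec_sndK S0 add0r scale1r (lieNl br_lie) mvzE !evE.
  ring.
by rewrite (kvector_size (kv_ce_diff1 _ s_lie)) ?addr0.
Qed.
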